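(* There exists an atomic linearly orderable (commutative) monoid $M$ whose finitary power monoid $\mathcal{P}_{\mathrm{fin}}(M)$ is not nearly atomic.
   Context: All monoids are commutative and written additively, with identity $0$. A monoid $M$ is linearly orderable if there is a total order $\preceq$ on $M$ such that $b \prec c$ implies $b+d \prec c+d$ for all $b,c,d \in M$. The finitary power monoid $\mathcal{P}_{\mathrm{fin}}(M)$ is the monoid of all nonempty finite subsets of $M$ under $S+T := \{s+t : s \in S, t \in T\}$. For a monoid $H$: $\mathcal{U}(H)$ is the group of invertible elements. An atom is an element $a \in H \setminus \mathcal{U}(H)$ such that $a = b+c$ with $b,c \in H$ implies $b \in \mathcal{U}(H)$ or $c \in \mathcal{U}(H)$. An element is atomic if it is invertible or a finite sum of atoms. $H$ is atomic if all its elements are atomic. $H$ is nearly atomic if there exists $c \in H$ such that $b+c$ is atomic for all $b \in H$. *)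

(* Defs.v *)
From HB Require Import structures.
From mathcomp Require Import all_boot all_order all_algebra finmap.

Set Implicit Arguments.
Unset Strict Implicit.
Unset Printing Implicit Defensive.

Import GRing.Theory.
Local Open Scope fset_scope.
Local Open Scope ring_scope.

Section MonoidNotions.

Variable H : nmodType.
Implicit Types (a b c x : H).

Definition invertible x : Prop := exists y, x + y = 0.

Definition atom a : Prop :=
  ~ invertible a /\ forall b c, a = b + c -> invertible b \/ invertible c.

(* The empty sum is 0, which is invertible, so allowing s = [::] is harmless. *)
Definition atomic_elt x : Prop :=
  invertible x \/
  exists s : seq H, (forall a, a \in s -> atom a) /\ x = \sum_(a <- s) a.

Definition atomic : Prop := forall x, atomic_elt x.

Definition nearly_atomic : Prop := exists c, forall b, atomic_elt (b + c).

Definition linearly_orderable : Prop :=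
  exists le : rel H,
    [/\ reflexive le, antisymmetric le, transitive le, total le
      & let lt x y := (x != y) && le x y in
        forall b c d, lt b c -> lt (b + d) (c + d)].

End MonoidNotions.

Arguments atomic H : clear implicits.
Arguments nearly_atomic H : clear implicits.
Arguments linearly_orderable H : clear implicits.

Section FinitaryPowerMonoid.

Variable M : nmodType.

Record Pfin := MkPfin { Pfin_set :> {fset M}; _ : Pfin_set != fset0 }.

HB.instance Definition _ := [isSub for Pfin_set].
HB.instance Definition _ := [Choice of Pfin by <:].

Implicit Types S T U : Pfin.

Definition sumset (S T : {fset M}) : {fset M} :=
  [fset s + t | s in S, t in T].

Lemma sumsetP (S T : {fset M}) x :
  reflect (exists s t, [/\ s \in S, t \in T & x = s + t]) (x \in sumset S T).
Proof.
apply: (iffP idP) => [/imfset2P[s sS [t tT ->]]|[s [t [sS tT ->]]]].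
  by exists s, t.
by apply/imfset2P; exists s => //; exists t.
Qed.

Fact Pfin_add_subproof S T : sumset S T != fset0.
Proof.
case: S T => [S /= /fset0Pn[s sS]] [T /= /fset0Pn[t tT]].
by apply/fset0Pn; exists (s + t); apply/sumsetP; exists s, t.
Qed.

Fact Pfin_zero_subproof : [fset (0 : M)] != fset0.
Proof. by apply/fset0Pn; exists 0; rewrite inE. Qed.

Definition Pfin_zero : Pfin := MkPfin Pfin_zero_subproof.
Definition Pfin_add S T : Pfin := MkPfin (Pfin_add_subproof S T).

Fact Pfin_addA : associative Pfin_add.
Proof.
move=> S T U; apply/val_inj/fsetP => x; apply/sumsetP/sumsetP.
  move=> [s [y [sS /sumsetP[t [u [tT uU ->]]] ->]]].
  by exists (s + t), u; split=> //; [apply/sumsetP; exists s, t | rewrite addrA].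
move=> [y [u [/sumsetP[s [t [sS tT ->]]] uU ->]]].
by exists s, (t + u); split=> //; [apply/sumsetP; exists t, u | rewrite addrA].
Qed.

Fact Pfin_addC : commutative Pfin_add.
Proof.
move=> S T; apply/val_inj/fsetP => x.
by apply/sumsetP/sumsetP => -[s [t [sS tT ->]]]; exists t, s; rewrite addrC.
Qed.

Fact Pfin_add0 : left_id Pfin_zero Pfin_add.
Proof.
move=> S; apply/val_inj/fsetP => x; apply/sumsetP/idP.
  by move=> [z [s [/fset1P-> sS ->]]]; rewrite add0r.
by move=> xS; exists 0, x; rewrite inE add0r.
Qed.

HB.instance Definition _ :=
  GRing.isNmodule.Build Pfin Pfin_addA Pfin_addC Pfin_add0.

End FinitaryPowerMonoid.

(* Main.v *)
(* In the free abelian group on d, x_j, u_(j,n) put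
   v_(j,n) = x_j - n d - u_(j,n), and let M be generated by the elements d,
   u_(j,n), v_(j,n), all of which are atoms of M.  For every n,
   x_j = n d + u_(j,n) + v_(j,n), so x_j is atomic, yet it is divisible by every
   multiple of d, and so are all elements involving x_j but no u_(j,n).
   Given a finite set C, choose J such that no element of C involves the indices
   J and J+1, and let B = {x_J, x_(J+1)}.  In a factorization of B + C, the
   coefficients of x_J and x_(J+1) sum to 1, hence exactly one factor A involves
   x_J or x_(J+1), and then every element of A involves one of the two.  The
   complementary factor R involves no u_(J,n): adding R to an element of A that
   involves x_(J+1) only, no cancellation of u_(J,n) is possible; symmetrically
   for J+1.  So every element of A is divisible by d, and A = {d} + A' is not an
   atom. *)
Require Import Defs.
From HB Require Import structures.
From mathcomp Require Import all_boot all_order all_algebra finmap.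
From mathcomp Require Import boolp zify.

Set Implicit Arguments.
Unset Strict Implicit.
Unset Printing Implicit Defensive.

Import Order.TTheory GRing.Theory Num.Theory.
Local Open Scope fset_scope.
Local Open Scope ring_scope.

(** * Linear orders from embeddings into polynomials *)

Lemma lead_coefD_ge0 (R : realDomainType) (p q : {poly R}) :
  0 <= lead_coef p -> 0 <= lead_coef q -> 0 <= lead_coef (p + q).
Proof.
move=> p0 q0; have [lt_pq|lt_qp|eq_pq] := ltngtP (size p) (size q).
- by rewrite lead_coefDr.
- by rewrite lead_coefDl.
(* In equal degree, nonnegative leading coefficients cancel only if both polynomials are zero. *)
have [pq0|pq0] := eqVneq (lead_coef p + lead_coef q) 0; last first.
  have [->|p_neq0] := eqVneq p 0; first by rewrite add0r.
  have sz : size (p + q) = size p.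
    apply/eqP; rewrite eqn_leq (leq_trans (size_polyD _ _)) ?eq_pq ?maxnn //=.
    rewrite -eq_pq -(prednK (n := size p)) ?size_poly_gt0 //.
    rewrite ltnNge; apply: contra pq0 => /leq_sizeP/(_ _ (leqnn _)).
    by rewrite coefD {2}eq_pq => ->.
  by rewrite lead_coefE sz coefD {2}eq_pq addr_ge0.
move/eqP: pq0; rewrite paddr_eq0 // !lead_coef_eq0 => /andP[/eqP-> /eqP->].
by rewrite addr0 lead_coef0.
Qed.

(** The lexicographic order on coefficients, decided at the highest degree where [p] and [q]
    differ. *)
Definition poly_le (R : realDomainType) : rel {poly R} :=
  fun p q => 0 <= lead_coef (q - p).

(** The order [poly_le] depends only on a difference, hence is translation invariant, and it pulls
    back along [f]. *)
Lemma poly_linearly_orderable (R : realDomainType) (H : nmodType)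
    (f : {additive H -> {poly R}}) : injective f -> linearly_orderable H.
Proof.
move=> f_inj; exists (fun a b => poly_le (f a) (f b)); split.
- by move=> a; rewrite /poly_le subrr lead_coef0.
- move=> a b /andP[]; rewrite /poly_le -opprB lead_coefN oppr_ge0 => le0 ge0.
  apply/f_inj/eqP; rewrite -subr_eq0 -lead_coef_eq0 eq_le ge0 andbT.
  exact: le0.
- move=> b a c ab bc; rewrite /poly_le.
  by rewrite -(subrKA (f b)) lead_coefD_ge0.
- move=> a b; rewrite /poly_le -(opprB (f b)) lead_coefN oppr_ge0.
  exact: le_total.
move=> lt a b c /andP[neq_ab le_ab]; rewrite /lt /poly_le.
rewrite (raddfD f b) (raddfD f a) opprD addrACA subrr addr0.
rewrite andbC [X in X && _]le_ab; apply: contra neq_ab.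
by move=> /eqP/(congr1 f); rewrite !raddfD /= => /addIr/f_inj->.
Qed.

(** * The ambient free abelian group and the generators *)

(* The free abelian group is realized as [{poly int}], the basis being the
   monomials numbered by the pickling of [idx]. *)
Definition idx : countType := option (nat * option nat)%type.
Definition idx_d : idx := None.
Definition idx_x (j : nat) : idx := Some (j, None).
Definition idx_u (j n : nat) : idx := Some (j, Some n).

Lemma idx_eqE :
  ((forall i, (idx_d == idx_x i) = false) *
   (forall i n, (idx_d == idx_u i n) = false) *
   (forall j, (idx_x j == idx_d) = false) *
   (forall j m, (idx_u j m == idx_d) = false) *
   (forall j i, (idx_x j == idx_x i) = (j == i)) *
   (forall j i n, (idx_x j == idx_u i n) = false) *
   (forall j m i, (idx_u j m == idx_x i) = false) *
   (forall j m i n, (idx_u j m == idx_u i n) = (j == i) && (m == n)))%type.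
Proof. by do !split => *; [exact: andbT | exact: andbF | exact: andbF]. Qed.

Definition cf (k : idx) (p : {poly int}) : int := p`_(choice.pickle k).
Definition bas (k : idx) : {poly int} := 'X^(choice.pickle k).

Lemma cf_bas k l : cf k (bas l) = (k == l)%:R.
Proof. by rewrite /cf coefXn (inj_eq (pcan_inj choice.pickleK)). Qed.

Lemma cf0 k : cf k 0 = 0. Proof. by rewrite /cf coef0. Qed.
Lemma cfD k p q : cf k (p + q) = cf k p + cf k q.
Proof. exact: coefD. Qed.
Lemma cfN k p : cf k (- p) = - cf k p.
Proof. exact: coefN. Qed.
Lemma cfMn k p n : cf k (p *+ n) = cf k p *+ n.
Proof. exact: coefMn. Qed.

Definition cfE :=
  (cfD, cfN, cfMn, cf_bas, cf0, idx_eqE, eqxx, andbT, mulr0n, mul0rn, subr0,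
   oppr0, addr0, add0r).

Notation gd := (bas idx_d).
Notation gx j := (bas (idx_x j)).
Notation gu j n := (bas (idx_u j n)).
Definition gv (j n : nat) : {poly int} := gx j - gd *+ n - gu j n.

Lemma gx_split (j n : nat) : gx j = gv j n + (gu j n + gd *+ n).
Proof. by rewrite /gv addrA !subrK. Qed.

(** Both sides are [gx j - gd *+ n]; passing from [n] to [n.+1] releases one copy of [gd]. *)
Lemma guv_shift (j n : nat) : gv j n + gu j n = gd + (gv j n.+1 + gu j n.+1).
Proof. by rewrite /gv !subrK [RHS]addrC mulrSr opprD addrA subrK. Qed.

(** * The generated submonoid and the signs of coordinates *)

Variant gen : {poly int} -> Prop :=
| GenD : gen gd
| GenU (j n : nat) : gen (gu j n)
| GenV (j n : nat) : gen (gv j n).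

Inductive inM : {poly int} -> Prop :=
| InM0 : inM 0
| InM_gen g p of gen g & inM p : inM (g + p).

Lemma inMD p q : inM p -> inM q -> inM (p + q).
Proof.
by elim=> [|g r gg _ IH] Mq; rewrite ?add0r // -addrA; apply: InM_gen (IH Mq).
Qed.

Lemma inM1 g : gen g -> inM g.
Proof. by move=> gg; rewrite -[g]addr0; apply: InM_gen gg InM0. Qed.

Lemma inM_gx (j : nat) : inM (gx j).
Proof.
rewrite (gx_split j 0) addr0; apply: inMD; apply: inM1; constructor.
Qed.

Lemma gen_cfx_ge0 (j : nat) g : gen g -> 0 <= cf (idx_x j) g.
Proof.
by case=> [|i n|i n]; rewrite /gv !cfE ?ler0n.
Qed.

Lemma cfx_ge0 (j : nat) p : inM p -> 0 <= cf (idx_x j) p.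
Proof.
by elim=> [|g q gg _ IH]; rewrite !cfE // addr_ge0 // gen_cfx_ge0.
Qed.

(** Only the generator [gv j n] is negative at [idx_u j n], and it is 1 at [idx_x j]. No generator
    is negative at [idx_x j], so a zero coordinate there excludes [gv j n]. *)
Lemma cfu_ge0 (j n : nat) p : inM p -> cf (idx_x j) p = 0 ->
  0 <= cf (idx_u j n) p.
Proof.
elim=> [|g q gg Mq IH]; rewrite !cfE // => /eqP.
rewrite paddr_eq0 ?(gen_cfx_ge0 _ gg) ?(cfx_ge0 _ Mq) //.
move=> /andP[/eqP g0 /eqP/IH q0].
rewrite addr_ge0 //; case: gg g0 => [|i m|i m]; rewrite /gv !cfE ?ler0n //.
by have [_|] := eqVneq j i.
Qed.

(** With every [gv] excluded, only basis elements remain as summands. *)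
Lemma cf_ge0 k p : inM p -> (forall j : nat, cf (idx_x j) p = 0) ->
  0 <= cf k p.
Proof.
elim=> [|g q gg Mq IH] x0; rewrite !cfE //.
have {}x0 (j : nat) : cf (idx_x j) g = 0 /\ cf (idx_x j) q = 0.
  have /eqP := x0 j; rewrite !cfE.
  rewrite paddr_eq0 ?(gen_cfx_ge0 _ gg) ?(cfx_ge0 _ Mq) //.
  by move=> /andP[/eqP-> /eqP->].
rewrite addr_ge0 ?IH //; last by move=> j; have [] := x0 j.
case: gg x0 => [|i m|i m] x0; rewrite ?cf_bas ?ler0n //.
by have [+ _] := x0 i; rewrite /gv !cfE.
Qed.

Lemma extract_gv (j : nat) p : inM p -> 0 < cf (idx_x j) p ->
  exists n q, inM q /\ p = gv j n + q.
Proof.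
elim=> [|g q gg Mq IH]; rewrite cfE // => g0.
have [q0|] := ltP 0 (cf (idx_x j) q).
  have [n [r [Mr ->]]] := IH q0; exists n, (g + r); split; last exact: addrCA.
  exact: InM_gen.
rewrite le_eqVlt ltNge cfx_ge0 // orbF => /eqP q0; move: g0; rewrite q0 addr0.
case: gg => [|i m|i m]; rewrite /gv !cfE //.
have [->|//] := eqVneq j i.
by move=> _; exists m, q.
Qed.

Lemma extract_gu (j n : nat) p : inM p -> 0 < cf (idx_u j n) p ->
  exists q, inM q /\ p = gu j n + q.
Proof.
elim=> [|g q gg Mq IH]; rewrite cfE // => g0.
have [q0|q0] := ltP 0 (cf (idx_u j n) q).
  have [r [Mr ->]] := IH q0; exists (g + r); split; last exact: addrCA.
  exact: InM_gen.
have {g0 q0} : 0 < cf (idx_u j n) g by lia.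
case: gg => [|i m|i m]; rewrite /gv !cfE //.
  case: andP => // -[/eqP-> /eqP->] _; by exists q.
by rewrite oppr_gt0 ltrn0.
Qed.

(** Some [gv j n] is a summand of [p]. Its coordinate -1 at [idx_u j n] must be compensated, so
    [gu j n] is a summand too, and [guv_shift] releases a [gd] from the pair. *)
Lemma inM_sub_gd (j : nat) p : inM p -> 0 < cf (idx_x j) p ->
  (forall n : nat, 0 <= cf (idx_u j n) p) -> inM (p - gd).
Proof.
move=> Mp x0 u0; have [n [q [Mq pE]]] := extract_gv Mp x0.
have [|r [Mr qE]] := @extract_gu j n q Mq.
  by have := u0 n; rewrite pE /gv !cfE; lia.
rewrite pE qE addrA guv_shift -[gd + _ + r]addrA [gd + _]addrC addrK.
by apply: inMD Mr; apply: inMD; apply: inM1; constructor.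
Qed.

(** * Irreducibility of the generators, and fresh indices *)

Lemma gen_add_neq0 g p : gen g -> inM p -> g + p <> 0.
Proof.
move=> gg Mp gp0; have cf_gp k : cf k g + cf k p = 0 by rewrite -cfD gp0 cf0.
have p_eq0 (j : nat) : cf (idx_x j) p = 0.
  by have := cf_gp (idx_x j);
     have := gen_cfx_ge0 j gg; have := cfx_ge0 j Mp; lia.
have p_ge0 k := cf_ge0 k Mp p_eq0.
case: gg cf_gp {gp0} => [|i m|i m] cf_gp.
- by have := cf_gp idx_d; have := p_ge0 idx_d; rewrite !cfE; lia.
- have := cf_gp (idx_u i m); have := p_ge0 (idx_u i m).
  by rewrite !cfE; lia.
by have := cf_gp (idx_x i); rewrite p_eq0 /gv !cfE.
Qed.

Lemma bas_gen_add_eq0 k l p : inM p -> (forall j : nat, cf (idx_x j) p = 0) ->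
  bas k = bas l + p -> p = 0.
Proof.
move=> Mp x0 kE; have := congr1 (cf l) kE; have := cf_ge0 l Mp x0.
rewrite cfD !cf_bas eqxx; have [lk|] := eqVneq l k; last by case: (cf l p).
by move=> _ _; move: kE; rewrite lk -[LHS]addr0 => /addrI.
Qed.

Lemma gv_gv_add_eq0 (j n i m : nat) p : inM p -> gv j n = gv i m + p -> p = 0.
Proof.
move=> Mp vE; have cfv k : cf k (gv j n) = cf k (gv i m) + cf k p.
  by rewrite vE cfD.
have ij : i = j.
  have := cfv (idx_x i); have := cfx_ge0 i Mp.
  rewrite /gv !cfE.
  by have [|_] := eqVneq i j; last lia.
subst i; have x0 (k : nat) : cf (idx_x k) p = 0.
  by have := cfv (idx_x k); rewrite /gv !cfE; lia.
have := cfv (idx_u j n); have := cf_ge0 (idx_u j n) Mp x0.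
rewrite /gv !cfE.
have [nm|_] := eqVneq n m; last lia.
by move=> _ _; move: vE; rewrite nm -[LHS]addr0 => /addrI.
Qed.

Lemma gen_gen_add_eq0 g h p : gen g -> gen h -> inM p -> g = h + p -> p = 0.
Proof.
move=> gg gh Mp gE; have cfg k : cf k g = cf k h + cf k p by rewrite gE cfD.
have x0 : (forall j : nat, cf (idx_x j) g = 0) ->
    forall j : nat, cf (idx_x j) h = 0 /\ cf (idx_x j) p = 0.
  move=> g0 j; have := cfg (idx_x j); rewrite g0.
  by have := gen_cfx_ge0 j gh; have := cfx_ge0 j Mp; lia.
have bas_case k : g = bas k -> (forall j : nat, cf (idx_x j) g = 0) -> p = 0.
  move=> gk /x0 {}x0; case: gh gE x0 {cfg} => [|i m|i m]; rewrite gk => gE x0.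
  - by apply: bas_gen_add_eq0 gE => // j; have [] := x0 j.
  - by apply: bas_gen_add_eq0 gE => // l; have [] := x0 l.
  by have [+ _] := x0 i; rewrite /gv !cfE.
case: gg gE cfg {x0} bas_case => [|j n|j n] gE cfg bas_case.
- by apply: (bas_case _ erefl) => j; rewrite cf_bas.
- by apply: (bas_case _ erefl) => i; rewrite cf_bas idx_eqE.
(* Here [g] is [gv j n]. If [h] is a basis element, [p] must supply the coordinate at [idx_x j], so
   [p = gv j m + q]; then [gv j n = gv j m + (h + q)] forces [h + q = 0], which is absurd. *)
have bas_h k : h = bas k -> cf (idx_x j) h = 0 -> p = 0.
  move=> hE h0; have [|m [q [Mq pE]]] := @extract_gv j p Mp.
    by have := cfg (idx_x j); rewrite h0 /gv !cfE => <-.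
  move: gE; rewrite pE addrCA => /gv_gv_add_eq0-/(_ (InM_gen gh Mq)).
  by move/(gen_add_neq0 gh Mq).
case: gh gE bas_h {cfg bas_case} => [|i m|i m] gE bas_h.
- by apply: (bas_h _ erefl); rewrite cf_bas idx_eqE.
- by apply: (bas_h _ erefl); rewrite cf_bas idx_eqE.
exact: gv_gv_add_eq0 gE.
Qed.

Lemma inM_fresh p : inM p ->
  exists J, forall j, (J <= j)%N ->
    cf (idx_x j) p = 0 /\ forall n, cf (idx_u j n) p = 0.
Proof.
elim=> [|g q gg _ [J IH]].
  by exists 0%N => j _; split=> [|n]; rewrite cf0.
have [I gI] : exists I, forall j, (I <= j)%N ->
    cf (idx_x j) g = 0 /\ forall n, cf (idx_u j n) g = 0.
  case: gg => [|i m|i m]; [exists 0%N|exists i.+1|exists i.+1] => j lt_ij;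
    split=> [|n];
    by rewrite /gv !cfE // gtn_eqF // !cfE.
exists (maxn I J) => j; rewrite geq_max => /andP[/gI[gx0 gu0] /IH[qx0 qu0]].
by split=> [|n]; rewrite cfD ?gx0 ?gu0 ?qx0 ?qu0.
Qed.

(** * The monoid as a type, and its atomicity *)

Definition in_mon : {pred {poly int}} := fun p => `[< inM p >].

Fact in_mon_closed : addr_closed in_mon.
Proof.
split=> [|p q /asboolP Mp /asboolP Mq]; apply/asboolP; first exact: InM0.
exact: inMD.
Qed.

Record mon := Mon { mon_val :> {poly int}; _ : in_mon mon_val }.

HB.instance Definition _ := [isSub for mon_val].
HB.instance Definition _ := [Choice of mon by <:].
HB.instance Definition _ := GRing.SubChoice_isSubNmodule.Build
  {poly int} in_mon mon in_mon_closed.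

Lemma mon_inM (a : mon) : inM (val a).
Proof. by case: a => p /= /asboolP. Qed.

Lemma mon_valD (a b : mon) : val (a + b) = val a + val b.
Proof. by []. Qed.

Definition mon_of p (Mp : inM p) : mon := @Mon p (asboolT Mp).

Lemma inM_add_eq0 p q : inM p -> inM q -> p + q = 0 -> p = 0.
Proof.
case=> // g r gg Mr Mq; rewrite -addrA => /gen_add_neq0-/(_ gg) [].
exact: inMD.
Qed.

Lemma mon_add_eq0 (a b : mon) : a + b = 0 -> a = 0.
Proof.
move=> /(congr1 val); rewrite mon_valD => ab0; apply: val_inj.
exact: inM_add_eq0 (mon_inM a) (mon_inM b) ab0.
Qed.

Lemma gen_atom (a : mon) : gen (val a) -> atom a.
Proof.
move=> ga; split=> [[b /(congr1 val)]|b c abc].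
  exact: gen_add_neq0 (mon_inM b).
have aE : val a = val b + val c by rewrite abc.
have [b0|[g [p [gg Mp bE]]]] : val b = 0 \/
    exists g p, [/\ gen g, inM p & val b = g + p].
    by case: (mon_inM b) => [|g p]; [left | right; exists g, p].
  by left; exists 0; rewrite addr0; apply: val_inj.
right; exists 0; rewrite addr0; apply: val_inj.
rewrite bE -addrA in aE.
have := gen_gen_add_eq0 ga gg (inMD Mp (mon_inM c)) aE.
by rewrite addrC => /inM_add_eq0-> //; apply: mon_inM.
Qed.

(** A derivation of [inM] lists generators that sum to the element, and generators are atoms. *)
Lemma mon_atomic : atomic mon.
Proof.
move=> a; right.
suff [s s_atom sE] : exists2 s : seq mon,
    forall b, b \in s -> atom b & val a = val (\sum_(b <- s) b).
  by exists s; split=> //; apply: val_inj.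
elim: (mon_inM a) => [|g p gg _ [s s_atom ->]].
  by exists [::] => //; rewrite big_nil.
exists (mon_of (inM1 gg) :: s); last by rewrite big_cons.
by move=> b; rewrite inE => /predU1P[->|/s_atom//]; apply: gen_atom.
Qed.

(** * Factorizations in the finitary power monoid *)

Lemma mem_PfinD (M : nmodType) (S T : Pfin M) x y :
  x \in Pfin_set S -> y \in Pfin_set T -> x + y \in Pfin_set (S + T).
Proof. by move=> xS yT; apply/sumsetP; exists x, y. Qed.

Lemma Pfin_neq0 (M : nmodType) (S : Pfin M) : exists x, x \in Pfin_set S.
Proof. by case: S => S /= /fset0Pn. Qed.

Lemma Pfin_sum_ind (M : nmodType) (P : M -> Prop) (s : seq (Pfin M)) :
  P 0 -> (forall x y, P x -> P y -> P (x + y)) ->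
  (forall S x, S \in s -> x \in Pfin_set S -> P x) ->
  forall x, x \in Pfin_set (\sum_(S <- s) S) -> P x.
Proof.
move=> P0 PD; elim: s => [_|S s IH Ps] x.
  by rewrite big_nil => /fset1P->.
rewrite big_cons => /sumsetP[y [z [yS zs ->]]]; apply: PD.
  by apply: Ps yS; rewrite mem_head.
by apply: IH zs => T t Ts; apply: Ps; rewrite inE Ts orbT.
Qed.

Lemma Pfin_mon_invertible (S : Pfin mon) a :
  invertible S -> a \in Pfin_set S -> a = 0.
Proof.
move=> [T ST0] aS; have [b bT] := Pfin_neq0 T.
by have := mem_PfinD aS bT; rewrite ST0 => /fset1P/mon_add_eq0.
Qed.

Lemma mon_fresh (C : {fset mon}) :
  exists J, forall j c, (J <= j)%N -> c \in C ->
    cf (idx_x j) (val c) = 0 /\ forall n, cf (idx_u j n) (val c) = 0.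
Proof.
have [J JP] := choice (fun c : mon => inM_fresh (mon_inM c)).
exists (\max_(c <- C) J c) => j c le_Jj cC; apply: JP.
apply: leq_trans le_Jj; exact: (leq_bigmax_seq c).
Qed.

(** Here [A] is [{d}] plus the set of all [b - d]. An invertible set contains only 0, whereas [d]
    and [a - d] are nonzero. *)
Lemma not_atom_of_sub_gd (A : Pfin mon) a :
  a \in Pfin_set A -> val a != gd ->
  (forall b, b \in Pfin_set A -> inM (val b - gd)) -> ~ atom A.
Proof.
move=> aA a_neq Asub [_ A_irr].
pose d : mon := mon_of (inM1 GenD).
(* By [Asub], the default 0 is never taken on elements of [A]. *)
pose f (b : mon) : mon := insubd (0 : mon) (val b - gd).
have fE b : b \in Pfin_set A -> b = d + f b.
  move=> bA; have f_val : val (f b) = val b - gd.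
    by apply: insubdK; apply/asboolP/Asub.
  have d_val : val d = gd by [].
  by apply: val_inj; rewrite mon_valD f_val d_val addrC subrK.
have D_neq0 : [fset d] != fset0 by apply/fset0Pn; exists d; rewrite inE.
have A'_neq0 : [fset f b | b in Pfin_set A] != fset0.
  by apply/fset0Pn; exists (f a); apply: in_imfset.
have : A = MkPfin D_neq0 + MkPfin A'_neq0.
  apply/val_inj/fsetP => b; apply/idP/sumsetP => [bA|].
    exists d, (f b); split; [by rewrite inE | exact: in_imfset | exact: fE].
  by move=> [_ [_ [/fset1P-> /imfsetP[c cA ->] ->]]]; rewrite -fE.
move=> /A_irr[] /Pfin_mon_invertible inv0.
  have /(congr1 val) /= d0 := inv0 d (fset11 _).
  by apply: (@gen_add_neq0 gd 0 GenD InM0); rewrite addr0.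
have fa0 : f a = 0 by apply: inv0; apply: in_imfset.
by move: a_neq; rewrite (fE a aA) fa0 addr0 eqxx.
Qed.

Lemma Pfin_mon_not_nearly_atomic : ~ nearly_atomic (Pfin mon).
Proof.
move=> [C C_near]; have [J fresh] := mon_fresh (Pfin_set C).
pose x i : mon := mon_of (inM_gx (J + i)%N).
have B_neq0 : [fset x 0%N; x 1%N] != fset0.
  by apply/fset0Pn; exists (x 0%N); rewrite !inE eqxx.
pose BC := MkPfin B_neq0 + C.
pose h i (a : mon) : int := cf (idx_x (J + i)%N) (val a).
pose u i n (a : mon) : int := cf (idx_u (J + i)%N n) (val a).
have hD i a b : h i (a + b) = h i a + h i b by apply: cfD.
have uD i n a b : u i n (a + b) = u i n a + u i n b by apply: cfD.
have h_ge0 i a : 0 <= h i a by apply/cfx_ge0/mon_inM.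
have u_ge0 i n a : h i a = 0 -> 0 <= u i n a by apply/cfu_ge0/mon_inM.
have hx i k c : c \in Pfin_set C -> h i (x k + c) = (i == k)%:R.
  move=> cC; rewrite hD /h (fresh _ _ (leq_addr _ _) cC).1 /= cf_bas idx_eqE.
  by rewrite eqn_add2l addr0.
have h_BC a : a \in Pfin_set BC -> h 0%N a + h 1%N a = 1.
  move=> /sumsetP[b [c [+ cC ->]]]; rewrite !inE => /orP[] /eqP->;
  by rewrite !hx.
have u_BC i n a : a \in Pfin_set BC -> u i n a = 0.
  move=> /sumsetP[b [c [+ cC ->]]]; rewrite !inE => /orP[] /eqP->;
  by rewrite uD /u (fresh _ _ (leq_addr _ _) cC).2 /= cf_bas idx_eqE.
have [c0 c0C] := Pfin_neq0 C.
have x_BC i : (i < 2)%N -> x i + c0 \in Pfin_set BC.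
  by case: i => [|[]] // _; apply: mem_PfinD c0C; rewrite !inE eqxx ?orbT.
case: (C_near (MkPfin B_neq0)) => [/Pfin_mon_invertible inv0 | [s [s_atom sE]]].
  have := h_BC _ (x_BC 0%N isT); rewrite (inv0 _ (x_BC 0%N isT)).
  by rewrite /h /= !cf0.
(* The sum of [h 0%N] and [h 1%N] is additive and equals 1 on [BC], so it cannot vanish on all
   factors. *)
have [A [a [As aA ha]]] : exists A a,
    [/\ A \in s, a \in Pfin_set A & h 0%N a + h 1%N a <> 0].
  apply: contrapT => no_A.
  suff : h 0%N (x 0%N + c0) + h 1%N (x 0%N + c0) = 0.
    by rewrite h_BC ?x_BC.
  apply: (@Pfin_sum_ind _ (fun b => h 0%N b + h 1%N b = 0) s).
  - by rewrite /h /= !cf0.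
  - by move=> b c hb hc; rewrite !hD addrACA hb hc.
  - by move=> A a As aA; apply: contrapT => ha; apply: no_A; exists A, a.
  by rewrite -sE x_BC.
pose R := \sum_(T <- rem A s) T.
have BC_AR : BC = A + R by rewrite /BC sE (big_rem A).
have AR b r : b \in Pfin_set A -> r \in Pfin_set R -> b + r \in Pfin_set BC.
  by rewrite BC_AR; apply: mem_PfinD.
(* By nonnegativity, [a] already uses up the total 1 available to [a + r]. *)
have hR i r : (i < 2)%N -> r \in Pfin_set R -> h i r = 0.
  move=> lti rR; have := h_BC _ (AR _ _ aA rR); rewrite !hD.
  have := (h_ge0 0%N a, h_ge0 1%N a, h_ge0 0%N r, h_ge0 1%N r).
  by move=> [[[]]]; case: i lti => [|[]] // _; lia.
(* An element a + r of BC with h i = 0 has u i n a, u i n r >= 0, so both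
   vanish; hence no u_(J+i,n) can be hidden in R. *)
have uR i n r : (i < 2)%N -> r \in Pfin_set R -> u i n r = 0.
  move=> lti rR; have ltk : ((1 - i) < 2)%N by lia.
  (* The other fresh index [1 - i] provides an element of [BC] on which [h i] vanishes. *)
  have : x (1 - i)%N + c0 \in Pfin_set (A + R) by rewrite -BC_AR x_BC.
  move=> /sumsetP[b [t [bA tR bt]]].
  have hb : h i b = 0.
    have := congr1 (h i) bt; rewrite hx // hD (hR i t) // addr0 => <-.
    by case: i lti {ltk bt} => [|[]].
  have := u_BC i n _ (AR _ _ bA rR); rewrite uD.
  have := u_ge0 i n b hb; have := u_ge0 i n r (hR i r lti rR); lia.
have [r rR] := Pfin_neq0 R.
apply: (@not_atom_of_sub_gd A a aA _ _ (s_atom A As)).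
  by apply/eqP => aE; apply: ha; rewrite /h aE !cf_bas !idx_eqE.
move=> b bA.
have hb : h 0%N b + h 1%N b = 1.
  by have := h_BC _ (AR _ _ bA rR); rewrite !hD !(hR _ _ _ rR) // !addr0.
have [i lti hib] : exists2 i, (i < 2)%N & 0 < h i b.
  have [h0|h0] := ltP 0 (h 0%N b); first by exists 0%N.
  by exists 1%N => //; move: hb h0; lia.
(* The coordinates [u i n] vanish on [BC] and on [R], hence on [b]. *)
apply: (@inM_sub_gd (J + i)%N) => //; first exact: mon_inM.
move=> n; have := u_BC i n _ (AR _ _ bA rR).
by rewrite uD (uR i n r) // addr0 /u => ->.
Qed.

Theorem theorem5p3 :
  exists M : nmodType,
    [/\ linearly_orderable M, atomic M & ~ nearly_atomic (Pfin M)].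
Proof.
exists mon; split.
- exact: (@poly_linearly_orderable _ _ (\val : {additive mon -> {poly int}})
    val_inj).
- exact: mon_atomic.
exact: Pfin_mon_not_nearly_atomic.
Qed.
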